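(* Let $A$ be a finite alphabet and let ${\bf X}=\{X_j\}_{j\in\mathbb{Z}}$ be a stationary process on $A$ that is a finitary process (FP), with stopping times $\theta_1$ and $\theta_2$. Then the concentration of measure holds at exponential rate for ${\bf X}$. Explicitly, let $n\ge1$, $\epsilon>0$ and let $f:A^n\to\mathbb{R}$ be a (non-constant) function. If $r_1$ and $r_2$ are positive integers such that $$\mathbb{P}(\{\theta_1>r_1\}\cup\{\theta_2>r_2\})\le\frac{\epsilon}{6\|\delta f\|_{\ell_1(\mathbb{N})}},$$ then $$\mathbb{P}\left(\left|f(X_1^n)-\mathbb{E}[f(X_1^n)]\right|>\epsilon\right)\le4\exp\left\{-\frac{2\epsilon^2}{9\left(1+r_2+\sum_{j=1}^{r_1}\mathbb{P}(\theta_1\ge j)\right)^2\|\delta f\|^2_{\ell_2(\mathbb{N})}}\right\}.$$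
   Context: Finitary process. Let ${\bf U}=\{U_i\}_{i\in\mathbb{Z}}$ be an i.i.d. process with values in a Polish space $\mathcal{U}$ and law $\mathbb{P}$. A stationary process ${\bf X}$ on $A$ with law $\mu$ is a finitary coding of ${\bf U}$ if there is a measurable $\Phi:\mathcal{U}^{\mathbb{Z}}\to A^{\mathbb{Z}}$ commuting with the shifts, with $\mu=\mathbb{P}\circ\Phi^{-1}$, and there are $\mathbb{P}$-a.s. finite maps $\theta_1,\theta_2:\mathcal{U}^{\mathbb{Z}}\to\mathbb{N}\cup\{\infty\}$ ($0$ allowed), called the stopping times, such that $\{\theta_1({\bf U})=k\}\cap\{\theta_2({\bf U})=l\}$ is measurable with respect to $\sigma(U_{-k},\ldots,U_l)$ for all finite $k,l$, and $[\Phi({\bf U})]_0=[\Phi({\bf V})]_0$ whenever ${\bf U}$ and ${\bf V}$ agree on all coordinates from $-\theta_1({\bf U})$ to $\theta_2({\bf U})$. One writes $\theta_i$ for $\theta_i({\bf U})$. A finitary process (FP) is a process that is a finitary coding of some i.i.d. process. For $f:A^n\to\mathbb{R}$ let $\delta_jf=\sup\{|f(a_1^n)-f(b_1^n)|:a_i=b_i\ \forall i\ne j\}$ and $\delta f=(\delta_1f,\ldots,\delta_nf)$, with $\|\delta f\|_{\ell_1(\mathbb{N})}=\sum_j\delta_jf$ and $\|\delta f\|_{\ell_2(\mathbb{N})}^2=\sum_j(\delta_jf)^2$. Here $X_1^n$ denotes $(X_1,\ldots,X_n)$ (the paper orders the coordinates with the future on the left). The concentration of measure holds at exponential rate for a stationary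 process ${\bf X}$ if there are a constant $C$ and a strictly positive function $g$ of two variables such that for all $n>0$, $\epsilon>0$ and all (non-constant) $f:A^n\to\mathbb{R}$, $$\mathbb{P}\left(|f(X_1^n)-\mathbb{E}[f(X_1^n)]|>\epsilon\right)\le C\exp\left\{-\frac{g(\epsilon,\|\delta f\|_{\ell_1(\mathbb{N})})}{\|\delta f\|^2_{\ell_2(\mathbb{N})}}\right\}.$$ *)

(* Defs.v *)
From HB Require Import structures.
From mathcomp Require Import all_boot all_order all_algebra finmap.
From mathcomp Require Import all_classical all_reals all_analysis.

Set Implicit Arguments.
Unset Strict Implicit.
Unset Printing Implicit Defensive.

Import Order.TTheory GRing.Theory Num.Theory.
Import numFieldTopology.Exports.

Local Open Scope classical_set_scope.
Local Open Scope ring_scope.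

(* Separable and completely metrizable; the metric is not part of the data. *)
Definition polish (R : realType) (U : topologicalType) : Prop :=
  (exists2 D : set U, countable D & dense D) /\
  exists dist : U -> U -> R,
    [/\ [/\ forall x y, 0 <= dist x y,
            forall x y, dist x y = 0 <-> x = y,
            forall x y, dist x y = dist y x &
            forall x y z, dist x z <= dist x y + dist y z],
        forall (x : U) (N : set U),
          nbhs x N <-> exists2 e : R, 0 < e & [set y | dist x y < e] `<=` N &
        forall u : nat -> U,
          (forall e : R, 0 < e -> exists N : nat,
             forall p q : nat, (N <= p)%N -> (N <= q)%N -> dist (u p) (u q) < e) ->
          exists x : U, u @ \oo --> x].

Definition borelType (U : ptopologicalType) := g_sigma_algebraType (@open U).

Definition coord_events (d : measure_display) (T : measurableType d)
    (I : set int) : set (set (int -> T)) :=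
  \bigcup_(i in I)
    preimage_set_system [set: int -> T] (fun x => x i) (@measurable d T).
Arguments coord_events {d} T I.

(* T^Z with its product sigma-algebra. *)
Definition pathType (d : measure_display) (T : measurableType d) :=
  g_sigma_algebraType (coord_events T [set: int]).
Arguments pathType {d} T.

Definition shift (T : Type) (x : int -> T) : int -> T := fun i => x (i + 1).

Definition iid_law (d : measure_display) (T : measurableType d) (R : realType)
    (P : probability (pathType T) R) : Prop :=
  (forall (i : int) (B : set T), measurable B ->
     P [set u | B (u i)] = P [set u | B (u 0)]) /\
  (forall (s : {fset int}) (B : int -> set T), (forall i, measurable (B i)) ->
     P (\bigcap_(i in [set` s]) [set u | B i (u i)]) =
     (\prod_(i <- s) P [set u | B i (u i)])%E).

Definition process_law (d dA : measure_display) (W : measurableType d)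
    (A : measurableType dA) (R : realType) (Q : probability W R)
    (X : int -> {RV Q >-> A}) : set (pathType A) -> \bar R :=
  pushforward Q (fun w : W => (fun i => X i w) : pathType A).

Definition stationary (d dA : measure_display) (W : measurableType d)
    (A : measurableType dA) (R : realType) (Q : probability W R)
    (X : int -> {RV Q >-> A}) : Prop :=
  forall B : set (pathType A), measurable B ->
    process_law X [set x | B (shift x)] = process_law X B.

(* Elements of N \cup {oo} are encoded in option nat, with None for oo. *)
Definition time_ge (t : option nat) (k : nat) : bool :=
  if t is Some m then (k <= m)%N else true.

Definition time_gt (t : option nat) (k : nat) : bool :=
  if t is Some m then (k < m)%N else true.

(* P(theta >= j). Finitary codings only make {theta1 = k} /\ {theta2 = l}
   measurable for finite k and l, hence {theta1 >= j} only up to a P-null set: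
   mu_ext P is P on measurable sets and the completion of P on such events. *)
Definition prob_ge (d : measure_display) (T : measurableType d) (R : realType)
    (P : probability T R) (theta : T -> option nat) (j : nat) : R :=
  fine (mu_ext P [set u | time_ge (theta u) j]).

(* i belongs to the integer interval from - t1 to t2. *)
Definition in_window (t1 t2 : option nat) (i : int) : Prop :=
  (if t1 is Some k then - k%:Z <= i else true) /\
  (if t2 is Some l then i <= l%:Z else true).

Definition finitary_coding (dV d dA : measure_display) (V : measurableType dV)
    (W : measurableType d) (A : measurableType dA) (R : realType)
    (P : probability (pathType V) R) (Q : probability W R)
    (X : int -> {RV Q >-> A}) (Phi : pathType V -> pathType A)
    (theta1 theta2 : pathType V -> option nat) : Prop :=
  [/\ [/\ measurable_fun [set: pathType V] Phi,
          forall u, Phi (shift u) = shift (Phi u) &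
          forall B : set (pathType A), measurable B ->
            process_law X B = pushforward P Phi B],
      {ae P, forall u, theta1 u <> None} /\ {ae P, forall u, theta2 u <> None},
      forall k l : nat,
        <<s coord_events V [set i | - k%:Z <= i <= l%:Z] >>
          [set u | theta1 u = Some k /\ theta2 u = Some l] &
      forall u v : pathType V,
        (forall i, in_window (theta1 u) (theta2 u) i -> u i = v i) ->
        Phi u 0 = Phi v 0].

Definition osc (A : Type) (R : realType) (n : nat) (f : n.-tuple A -> R)
    (j : 'I_n) : R :=
  sup [set r | exists a b : n.-tuple A,
         (forall i : 'I_n, i != j -> tnth a i = tnth b i) /\
         r = `|f a - f b|].

Definition osc_l1 (A : Type) (R : realType) (n : nat) (f : n.-tuple A -> R) : R :=
  \sum_(j < n) osc f j.

(* The square of the l2 norm. *)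
Definition osc_l2sq (A : Type) (R : realType) (n : nat) (f : n.-tuple A -> R) : R :=
  \sum_(j < n) osc f j ^+ 2.

(* (X_1, ..., X_n): position i, counted from 0, holds X_(i+1). *)
Definition block (d dA : measure_display) (W : measurableType d)
    (A : measurableType dA) (R : realType) (Q : probability W R)
    (X : int -> {RV Q >-> A}) (n : nat) (w : W) : n.-tuple A :=
  [tuple X (i.+1)%:Z w | i < n].

Definition deviation_prob (d dA : measure_display) (W : measurableType d)
    (A : measurableType dA) (R : realType) (Q : probability W R)
    (X : int -> {RV Q >-> A}) (n : nat) (f : n.-tuple A -> R) (eps : R) : \bar R :=
  Q [set w | eps < `|f (block X n w) - fine ('E_Q[fun w' => f (block X n w')])|].

Definition exp_rate_concentration (d dA : measure_display) (W : measurableType d)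
    (A : measurableType dA) (R : realType) (Q : probability W R)
    (X : int -> {RV Q >-> A}) : Prop :=
  exists (C : R) (g : R -> R -> R),
    (forall x y, 0 < g x y) /\
    forall (n : nat) (eps : R) (f : n.-tuple A -> R),
      (0 < n)%N -> 0 < eps -> (exists a b, f a <> f b) ->
      (deviation_prob X f eps <=
         (C * expR (- (g eps (osc_l1 f) / osc_l2sq f)))%:E)%E.

(* Main.v *)
Require Import Defs.
From HB Require Import structures.
From mathcomp Require Import all_boot all_order all_algebra finmap.
From mathcomp Require Import all_classical all_reals all_analysis.
From mathcomp Require Import measurable_realfun ring lra zify.

(** A finitary coding reads X_j off the i.i.d. input U inside a random window
    around j, and the argument is a bounded-difference inequality for functions
    of U that takes advantage of the windows being random.

    Truncation. Replace each letter X_j by a readout, which is X_j if the window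
    at j stays in [j - r1, j + r2] and an overrun mark otherwise. Functions of
    n readouts then depend on n + r1 + r2 input coordinates.

    Conditional expectations. Since the coordinates of U are independent, the
    conditional expectation given the coordinates before m is the integral over a
    resampled future (cexp). Everything is done on the path space of U with
    this operator; its tower property and Hoeffding's lemma give the
    Azuma-Hoeffding inequality (azuma_hoeffding).

    Influences. Resampling U_m changes the readout at j only if j - r1 <= m <=
    j + r2. For m < j, a change also requires that the window at j reach back to
    m. Up to a null event, whether it does is decided by the coordinates after m,
    which are independent of those up to m, so even conditionally on the latter
    the change has probability at most P(theta1 >= j - m) (readout_influence).
    Hence the martingale increments are bounded by the convolution of the
    oscillations of f with a kernel of total mass
    1 + r2 + sum_(1 <= k <= r1) P(theta1 >= k), and its l2 norm is controlled by
    schur_test. This is readout_concentration.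

    Conclusion. The error of the truncation is at most the sum F2 of the
    oscillations of f at the overruns. It is itself a function of the readouts
    with the same oscillations, so it concentrates at the same rate around its
    mean, which the choice of r1 and r2 makes at most eps / 6
    (coding_concentration). The deviation probability depends only on the law of
    X, which is that of the coding; and as the stopping times are almost surely
    finite, admissible r1 and r2 exist for each eps and each l1 norm, which gives
    the rate function. *)

Set Implicit Arguments.
Unset Strict Implicit.
Unset Printing Implicit Defensive.

Import Order.TTheory GRing.Theory Num.Theory.
Import numFieldTopology.Exports numFieldNormedType.Exports.

Local Open Scope classical_set_scope.
Local Open Scope ring_scope.

(** * Real inequalities *)

Lemma ge0_deriv_homo (R : realType) (f df : R -> R) (x : R) :
  (forall z : R, is_derive z (1 : R) f (df z)) -> (forall z, 0 <= z -> 0 <= df z) ->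
  0 <= x -> f 0 <= f x.
Proof.
move=> fdf df0; rewrite le_eqVlt => /predU1P[<-//|x0].
have [|c /itvP cx fE] := @MVT R f df 0 x x0 (fun z _ => fdf z).
  apply: derivable_within_continuous => z _.
  by have [] := fdf z.
by rewrite -subr_ge0 fE mulr_ge0 ?df0 ?subr0 ?(ltW x0)// ltW// cx.
Qed.

(** Worst case of Hoeffding's lemma: a centred variable taking two values at
    distance 1. In logarithmic form the right side minus the left side has
    value and slope 0 at 0, and its second derivative is 1/4 - v(1-v) >= 0 for
    the weight v of the upper value in the exponentially tilted law. *)
Lemma hoeffding_two_point (R : realType) (p s : R) : 0 <= p <= 1 -> 0 <= s ->
  p * expR ((1 - p) * s) + (1 - p) * expR (- p * s) <= expR (s ^+ 2 / 8).
Proof.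
move=> /andP[p0 p1] s0.
(* D is the moment generating function of the variable with values 0 and 1;
   f, with derivative g and second derivative h, is the logarithmic gap. *)
pose D (x : R) : R := 1 - p + p * expR x.
have D0 x : 0 < D x.
  rewrite /D; have := expR_gt0 x; move: p0; rewrite le_eqVlt => /predU1P[<- _|p0 e0].
    by lra.
  by rewrite ltr_wpDl ?mulr_gt0// subr_ge0.
pose g (x : R) : R := x / 4 + p - p * expR x / D x.
pose f (x : R) : R := x ^+ 2 / 8 + p * x - ln (D x).
have dD (z : R) : is_derive z (1 : R) D (p * expR z).
  rewrite /D; apply: trigger_derive; rewrite /GRing.scale/=.
  by ring.
have dlnD (z : R) : is_derive z (1 : R) (fun x => ln (D x)) (p * expR z / D z).
  have := is_derive1_comp (is_derive1_ln (D0 z)) (dD z).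
  by rewrite mulrC.
have dinvD (z : R) : is_derive z (1 : R) (fun x => (D x)^-1) (- (D z) ^- 2 * (p * expR z)).
  by apply: is_deriveV; rewrite gt_eqF.
have fd (z : R) : is_derive z (1 : R) f (g z).
  rewrite /f.
  have -> : g z = (2 * z / 8 + p) - p * expR z / D z by rewrite /g; field; rewrite gt_eqF.
  apply: is_deriveB => //.
  apply: trigger_derive; rewrite /GRing.scale/=.
  by field.
pose h (x : R) : R := 1 / 4 - p * (1 - p) * expR x / D x ^+ 2.
have gd (z : R) : is_derive z (1 : R) g (h z).
  have -> : h z = 1/4 - (p * expR z * (- (D z) ^- 2 * (p * expR z)) +
                    (D z)^-1 * (p * expR z)).
    by rewrite /h /D; field; rewrite -/(D z) gt_eqF.
  apply: (@is_deriveB _ _ _ (fun x : R => x / 4 + p) (fun x => p * expR x / D x)).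
    apply: trigger_derive; rewrite /GRing.scale/=.
    by field.
  apply: (@is_deriveM _ _ (fun x : R => p * expR x) (fun x => (D x)^-1)) => //.
have h0 z : 0 <= h z.
  rewrite /h subr_ge0 ler_pdivrMr ?exprn_gt0//.
  rewrite -subr_ge0; set e := expR z.
  have -> : 1 / 4 * D z ^+ 2 - p * (1 - p) * e = (1 - p - p * e) ^+ 2 / 4.
    by rewrite /D -/e; field.
  by rewrite mulr_ge0 ?sqr_ge0.
have g0 z : 0 <= z -> 0 <= g z.
  move=> z0; have <- : g 0 = 0.
    by rewrite /g /D expR0; field; apply/eqP; lra.
  by apply: (ge0_deriv_homo gd) => // w _; exact: h0.
have : 0 <= f s.
  have <- : f 0 = 0.
    by rewrite /f /D expR0 mulr1 addrNK ln1; ring.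
  exact: (ge0_deriv_homo fd).
rewrite /f subr_ge0 -ler_expR lnK ?posrE//.
have -> : p * expR ((1 - p) * s) + (1 - p) * expR (- p * s) =
   D s * expR (- p * s).
  rewrite /D [RHS]mulrDl [LHS]addrC -[X in _ = _ + X]mulrA -expRD; congr (_ + p * expR _); ring.
move=> /(ler_wpM2r (expR_ge0 (- p * s))) /le_trans; apply.
by rewrite -expRD mulNr addrK.
Qed.

(** Cauchy-Schwarz for the weights a: the gap is half the double sum of
    a_i a_j (x_i - x_j)^2. *)
Lemma sqr_sum_weighted (R : realType) (I : finType) (a x : I -> R) :
  (forall i, 0 <= a i) ->
  (\sum_i a i * x i) ^+ 2 <= (\sum_i a i) * (\sum_i a i * x i ^+ 2).
Proof.
move=> a0; rewrite -subr_ge0.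
suff -> : (\sum_i a i) * (\sum_i a i * x i ^+ 2) - (\sum_i a i * x i) ^+ 2 =
    2^-1 * \sum_i \sum_j a i * a j * (x i - x j) ^+ 2.
  rewrite mulr_ge0// ?invr_ge0//; do 2 (apply: sumr_ge0 => ? _).
  by rewrite mulr_ge0 ?sqr_ge0// mulr_ge0.
have E1 : \sum_i \sum_j a i * a j * x i ^+ 2 =
    (\sum_i a i) * (\sum_i a i * x i ^+ 2).
  rewrite mulrC big_distrl/=; apply: eq_bigr => i _.
  by rewrite big_distrr/=; apply: eq_bigr => j _; ring.
have E2 : \sum_i \sum_j a i * a j * x j ^+ 2 =
    (\sum_i a i) * (\sum_i a i * x i ^+ 2).
  rewrite big_distrl/=; apply: eq_bigr => i _.
  by rewrite big_distrr/=; apply: eq_bigr => j _; ring.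
have E3 : \sum_i \sum_j a i * a j * (x i * x j) = (\sum_i a i * x i) ^+ 2.
  rewrite expr2 big_distrl/=; apply: eq_bigr => i _.
  by rewrite big_distrr/=; apply: eq_bigr => j _; ring.
transitivity (2^-1 * (\sum_i \sum_j a i * a j * x i ^+ 2 +
   \sum_i \sum_j a i * a j * x j ^+ 2 - 2 * \sum_i \sum_j a i * a j * (x i * x j))).
  by rewrite E1 E2 E3; field.
congr (_ * _).
rewrite mulr_sumr -sumrN -!big_split/=; apply: eq_bigr => i _.
rewrite mulr_sumr -sumrN -!big_split/=; apply: eq_bigr => j _.
by ring.
Qed.

(** A nonnegative kernel whose rows and columns sum to at most K acts on l2 with
    norm at most K; for a convolution kernel this is Young's inequality. *)
Lemma schur_test (R : realType) (I J : finType) (k : I -> J -> R) (x : J -> R)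
    (K : R) : (forall i j, 0 <= k i j) ->
  (forall i, \sum_j k i j <= K) -> (forall j, \sum_i k i j <= K) ->
  \sum_i (\sum_j k i j * x j) ^+ 2 <= K ^+ 2 * \sum_j x j ^+ 2.
Proof.
move=> k0 krow kcol.
have [i0 _|I0] := pickP (fun _ : I => true); last first.
  rewrite big1 => [|i _]; last by have := I0 i.
  by apply: mulr_ge0; rewrite ?sqr_ge0// sumr_ge0// => j _; exact: sqr_ge0.
have K0 : 0 <= K by rewrite (le_trans _ (krow i0))// sumr_ge0.
apply: (@le_trans _ _ (\sum_i K * \sum_j k i j * x j ^+ 2)).
  apply: ler_sum => i _; apply: (le_trans (sqr_sum_weighted _ _)) => //.
  by rewrite ler_wpM2r// sumr_ge0// => j _; rewrite mulr_ge0 ?sqr_ge0.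
rewrite -mulr_sumr expr2 -mulrA ler_wpM2l// exchange_big/= mulr_sumr.
by apply: ler_sum => j _; rewrite -mulr_suml ler_wpM2r ?sqr_ge0.
Qed.

(** The rows and columns of the causal convolution by k are truncated copies of
    k, so their sums are at most the sum of k. *)
Lemma sum_toeplitz_row (R : realType) (k : nat -> R) (L i n : nat) :
  (forall e, 0 <= k e) -> (forall e, (L <= e)%N -> k e = 0) ->
  \sum_(j < n) (if (j <= i)%N then k (i - j)%N else 0) <= \sum_(e < L) k e.
Proof.
move=> k0 kL.
have zl m a : (L <= a)%N -> \sum_(a <= e < m) k e = 0.
  by move=> La; rewrite big_nat big1// => e /andP[ae _]; rewrite kL// (leq_trans La).
have bound m : \sum_(e < m) k e <= \sum_(e < L) k e.
  rewrite -!(big_mkord xpredT); have [mL|Lm] := leqP m L.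
    by rewrite (big_cat_nat _ mL)//= lerDl sumr_ge0.
  by rewrite (big_cat_nat _ (ltnW Lm))//= (zl m L)// addr0.
apply: le_trans (bound i.+1).
rewrite -!(big_mkord xpredT) -(big_mkord xpredT (fun j => if (j <= i)%N then k (i - j)%N else 0)).
rewrite [leRHS]big_nat_rev/= add0n.
pose F j := if (j <= i)%N then k (i - j)%N else 0.
rewrite [leRHS](eq_big_nat _ _ (F2 := F)); last first.
  by move=> j /andP[_ ji]; rewrite /F -ltnS ji subSS.
have F0 j : 0 <= F j by rewrite /F; case: ifP.
have [ni|ni] := leqP n i.+1.
  by rewrite [leRHS](big_cat_nat _ ni)//= lerDl sumr_ge0.
rewrite (big_cat_nat _ (ltnW ni))//= [X in _ + X]big_nat [X in _ + X]big1 ?addr0//.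
by move=> j /andP[ij _]; rewrite leqNgt ij.
Qed.

Lemma sum_toeplitz_col (R : realType) (k : nat -> R) (L j n : nat) :
  (forall e, 0 <= k e) -> (forall e, (L <= e)%N -> k e = 0) ->
  \sum_(i < n) (if (j <= i)%N then k (i - j)%N else 0) <= \sum_(e < L) k e.
Proof.
move=> k0 kL; pose F i := if (j <= i)%N then k (i - j)%N else 0.
have F0 i : 0 <= F i by rewrite /F; case: ifP.
rewrite -(big_mkord xpredT F) -(big_mkord xpredT k).
apply: (@le_trans _ _ (\sum_(0 <= i < j + (L + n)) F i)).
  by rewrite (@big_cat_nat _ _ _ n 0 (j + (L + n)))//= ?lerDl ?sumr_ge0// addnCA addnA leq_addl.
rewrite (@big_cat_nat _ _ _ j)//= ?leq_addr// big_nat big1 ?add0r; last first.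
  by move=> i /andP[_ ij]; rewrite /F leqNgt ij.
rewrite -[X in \sum_(X <= _ < _) _](add0n j) big_addn addKn.
rewrite (@big_cat_nat _ _ _ L)//= ?leq_addr//.
rewrite [X in _ + X]big_nat [X in _ + X]big1 ?addr0.
  by apply: ler_sum => e _; rewrite /F leq_addl addnK.
by move=> e /andP[Le _]; rewrite /F leq_addl addnK kL.
Qed.

(** * Bounded random variables: Hoeffding's lemma and Chernoff's bound *)

Section bounded_random_variables.
Context (d : measure_display) (T : measurableType d) (R : realType).

(** Bounded measurable functions are closed under all the operations below and
    integrable for every probability, which disposes of integrability. *)
Definition bounded_mf (F : T -> R) : Prop :=
  measurable_fun [set: T] F /\ exists M, forall x, `|F x| <= M.

Lemma bounded_mf_cst c : bounded_mf (fun=> c).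
Proof. by split; [exact: measurable_cst|exists `|c|]. Qed.

Lemma bounded_mfD F G : bounded_mf F -> bounded_mf G ->
  bounded_mf (fun x => F x + G x).
Proof.
move=> [mF [M FM]] [mG [N GN]]; split; first exact: measurable_funD.
by exists (M + N) => x; rewrite (le_trans (ler_normD _ _))// lerD.
Qed.

Lemma bounded_mfM F G : bounded_mf F -> bounded_mf G ->
  bounded_mf (fun x => F x * G x).
Proof.
move=> [mF [M FM]] [mG [N GN]]; split; first exact: measurable_funM.
by exists (M * N) => x; rewrite normrM ler_pM.
Qed.

Lemma bounded_mfN F : bounded_mf F -> bounded_mf (fun x => - F x).
Proof.
move=> [mF [M FM]]; split; first exact: measurableT_comp.
by exists M => x; rewrite normrN.
Qed.

Lemma bounded_mf_norm F : bounded_mf F -> bounded_mf (fun x => `|F x|).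
Proof.
move=> [mF [M FM]]; split; first exact: measurableT_comp.
by exists M => x; rewrite normr_id.
Qed.

Lemma bounded_mf_expR F : bounded_mf F -> bounded_mf (fun x => expR (F x)).
Proof.
move=> [mF [M FM]]; split; first exact: measurableT_comp.
exists (expR M) => x; rewrite ger0_norm ?expR_ge0// ler_expR.
by rewrite (le_trans _ (FM x))// ler_norm.
Qed.

Lemma bounded_mf_sum (I : Type) (r : seq I) (F : I -> T -> R) :
  (forall i, bounded_mf (F i)) -> bounded_mf (fun x => \sum_(i <- r) F i x).
Proof.
move=> bF; elim: r => [|i r IH].
  rewrite [X in bounded_mf X](_ : _ = fun=> 0); first exact: bounded_mf_cst.
  by apply/funext => x; rewrite big_nil.
rewrite [X in bounded_mf X](_ : _ = fun x => F i x + \sum_(j <- r) F j x).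
  exact: bounded_mfD.
by apply/funext => x; rewrite big_cons.
Qed.

Lemma bounded_mf_indic (A : set T) : measurable A -> bounded_mf \1_A.
Proof.
move=> mA; split; first exact: measurable_indic.
by exists 1 => x; rewrite indicE; case: (x \in A); rewrite ?normr1 ?normr0.
Qed.

Variable P : probability T R.

Lemma bounded_mf_integrable F : bounded_mf F -> P.-integrable setT (EFin \o F).
Proof.
move=> [mF [M FM]]; apply: measurable_bounded_integrable => //.
  by rewrite (le_lt_trans (probability_le1 _ _))// ltry.
exists M; split; first exact: num_real.
by move=> x Mx y _ /=; exact: le_trans (FM y) (ltW Mx).
Qed.

Lemma expect_le F G : bounded_mf F -> bounded_mf G ->
  (forall x, F x <= G x) -> \int[P]_x F x <= \int[P]_x G x.
Proof.
by move=> bF bG FG; apply: le_Rintegral => //; exact: bounded_mf_integrable.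
Qed.

Lemma expectD F G : bounded_mf F -> bounded_mf G ->
  \int[P]_x (F x + G x) = \int[P]_x F x + \int[P]_x G x.
Proof. by move=> bF bG; apply: RintegralD => //; exact: bounded_mf_integrable. Qed.

Lemma expectB F G : bounded_mf F -> bounded_mf G ->
  \int[P]_x (F x - G x) = \int[P]_x F x - \int[P]_x G x.
Proof. by move=> bF bG; apply: RintegralB => //; exact: bounded_mf_integrable. Qed.

Lemma expectZ c F : bounded_mf F -> \int[P]_x (c * F x) = c * \int[P]_x F x.
Proof. by move=> bF; apply: RintegralZl => //; exact: bounded_mf_integrable. Qed.

Lemma expectN F : bounded_mf F -> \int[P]_x (- F x) = - \int[P]_x F x.
Proof.
move=> bF; rewrite -mulN1r -expectZ//.
by apply: eq_Rintegral => x _; rewrite mulN1r.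
Qed.

Lemma expect_cst c : \int[P]_x (fun=> c) x = c.
Proof. by rewrite Rintegral_cst//= probability_setT mulr1. Qed.

Lemma expect_sum (I : Type) (r : seq I) (F : I -> T -> R) :
  (forall i, bounded_mf (F i)) ->
  \int[P]_x (\sum_(i <- r) F i x) = \sum_(i <- r) \int[P]_x F i x.
Proof.
move=> bF; elim: r => [|i r IH].
  rewrite big_nil -[RHS](expect_cst 0); apply: eq_Rintegral => x _.
  by rewrite big_nil.
rewrite big_cons -IH -expectD//; last exact: bounded_mf_sum.
by apply: eq_Rintegral => x _; rewrite big_cons.
Qed.

Lemma expect_indic (A : set T) : measurable A -> \int[P]_x \1_A x = fine (P A).
Proof. by move=> mA; rewrite /Rintegral integral_indic// setIT. Qed.

Lemma expect_dist F G H : bounded_mf F -> bounded_mf G -> bounded_mf H ->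
  (forall x, `|F x - G x| <= H x) ->
  `|\int[P]_x F x - \int[P]_x G x| <= \int[P]_x H x.
Proof.
move=> bF bG bH FGH; rewrite -expectB//.
have bFG : bounded_mf (fun x => F x - G x) by apply/bounded_mfD/bounded_mfN.
apply: (le_trans (le_normr_Rintegral _ _)) => //; first exact: bounded_mf_integrable.
by apply: expect_le => //; exact: bounded_mf_norm.
Qed.

(** By convexity expR (s * g) lies below its chord over an interval of length c
    containing the range of g; integrating the chord leaves the two-point
    inequality, with weight p given by the position of the mean. *)
Lemma hoeffding_lemma (g : T -> R) (c s : R) : bounded_mf g ->
  (forall x y, g x - g y <= c) -> 0 <= s ->
  \int[P]_x expR (s * g x) <= expR (s ^+ 2 * c ^+ 2 / 8) * expR (s * \int[P]_x g x).
Proof.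
move=> bg gc s0; set m := \int[P]_x g x.
pose a := inf (range g).
have hlb : has_lbound (range g).
  have [_ [M gM]] := bg; exists (- M) => _ [x _ <-].
  by have := gM x; rewrite ler_norml => /andP[].
have ag x : a <= g x by apply: ge_inf => //; exists x.
have ga x : g x <= a + c.
  rewrite -lerBlDr; apply: lb_le_inf; first by exists (g x), x.
  by move=> _ [y _ <-]; rewrite lerBlDr -lerBlDl gc.
have c0 : 0 <= c by have := gc point point; rewrite subrr.
have am : a <= m.
  by rewrite -(expect_cst a); apply: expect_le => //; exact: bounded_mf_cst.
have mac : m <= a + c.
  by rewrite -(expect_cst (a + c)); apply: expect_le => //; exact: bounded_mf_cst.
have bsg : bounded_mf (fun x => s * g x) by apply: bounded_mfM => //; exact: bounded_mf_cst.
move: c0; rewrite le_eqVlt => /predU1P[c0|c0].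
  rewrite -c0 expr0n/= mulr0 mul0r expR0 mul1r.
  rewrite -[leRHS]expect_cst; apply: expect_le.
  - exact: bounded_mf_expR.
  - exact: bounded_mf_cst.
  - move=> x; rewrite ler_expR ler_wpM2l//.
    by rewrite (le_trans (ga x))// -c0 addr0.
pose p := (m - a) / c.
have p01 : 0 <= p <= 1.
  by rewrite /p divr_ge0 ?subr_ge0 ?(ltW c0)//= ler_pdivrMr// mul1r lerBlDl.
pose u x := (g x - a) / c.
have u01 x : 0 <= u x <= 1.
  by rewrite /u divr_ge0 ?subr_ge0 ?(ltW c0)//= ler_pdivrMr// mul1r lerBlDl.
have bu : bounded_mf u.
  apply: bounded_mfM; last exact: bounded_mf_cst.
  by apply: bounded_mfD => //; exact: bounded_mf_cst.
have up : \int[P]_x u x = p.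
  rewrite /u /p mulrC.
  have <- : \int[P]_x (g x - a) = m - a.
    by rewrite expectB ?expect_cst//; exact: bounded_mf_cst.
  rewrite -expectZ; last by apply: bounded_mfD => //; exact: bounded_mf_cst.
  by apply: eq_Rintegral => x _; rewrite mulrC.
apply: (@le_trans _ _ (\int[P]_x (expR (s * a) + (expR (s * (a + c)) - expR (s * a)) * u x))).
  apply: expect_le.
  - exact: bounded_mf_expR.
  - apply: bounded_mfD; first exact: bounded_mf_cst.
    by apply: bounded_mfM => //; exact: bounded_mf_cst.
  - move=> x; have /andP[u0 u1] := u01 x.
    have u0' : 0 <= 1 - u x <= 1 by lra.
    pose t : {i01 R} := Itv01 u0 u1.
    have := @convex_expR R t (s * (a + c)) (s * a).
    rewrite !convRE /= /t /unstable.onem/=.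
    have -> : u x * (s * (a + c)) + (1 - u x) * (s * a) = s * g x.
      by rewrite /u; field; rewrite gt_eqF.
    move=> /le_trans; apply; lra.
rewrite expectD; last 2 first.
- exact: bounded_mf_cst.
- by apply: bounded_mfM => //; exact: bounded_mf_cst.
rewrite expect_cst expectZ// up.
have := hoeffding_two_point p01 (mulr_ge0 s0 (ltW c0)).
rewrite exprMn => /(ler_wpM2r (expR_ge0 (s * m))) /(le_trans _); apply.
rewrite [leRHS]mulrDl -[X in _ <= X + _]mulrA -[X in _ <= _ + X]mulrA -!expRD.
have -> : (1 - p) * (s * c) + s * m = s * (a + c) by rewrite /p; field; rewrite gt_eqF.
have -> : - p * (s * c) + s * m = s * a by rewrite /p; field; rewrite gt_eqF.
lra.
Qed.

Lemma measurable_ge_level F t : bounded_mf F -> measurable [set x | t <= F x].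
Proof.
move=> bF; have := measurable_fun_ler (@measurable_cst _ _ T R setT t) (proj1 bF).
by move=> /(_ measurableT [set true] Logic.I); rewrite setTI.
Qed.

Lemma measurable_gt_level F t : bounded_mf F -> measurable [set x | t < F x].
Proof.
move=> bF; have := measurable_fun_ltr (@measurable_cst _ _ T R setT t) (proj1 bF).
by move=> /(_ measurableT [set true] Logic.I); rewrite setTI.
Qed.

Lemma chernoff_bound (F : T -> R) (s t K : R) : bounded_mf F -> 0 <= s ->
  \int[P]_x expR (s * F x) <= K ->
  fine (P [set x | t <= F x]) <= expR (- (s * t)) * K.
Proof.
move=> bF s0 EK.
rewrite -expect_indic; last exact: measurable_ge_level.
have bsF : bounded_mf (fun x => s * F x) by apply: bounded_mfM => //; exact: bounded_mf_cst.
apply: (@le_trans _ _ (\int[P]_x (expR (- (s * t)) * expR (s * F x)))).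
  apply: expect_le.
  - exact/bounded_mf_indic/measurable_ge_level.
  - by apply: bounded_mfM; [exact: bounded_mf_cst|exact: bounded_mf_expR].
  - move=> x; rewrite indicE; case: (boolP (x \in _)) => [|_]; last by rewrite mulr_ge0 ?expR_ge0.
    rewrite inE/= -expRD => tF; rewrite -(@expR0 R) ler_expR addrC subr_ge0.
    exact: ler_wpM2l.
by rewrite expectZ ?ler_wpM2l ?expR_ge0//; exact: bounded_mf_expR.
Qed.

End bounded_random_variables.

Lemma bounded_mf_comp (R : realType) (d d' : measure_display)
    (T : measurableType d) (Z : measurableType d') (g : T -> Z) (F : Z -> R) :
  measurable_fun [set: T] g -> bounded_mf F -> bounded_mf (fun x => F (g x)).
Proof.
move=> mg [mF [M FM]]; split; first exact: measurableT_comp mF mg.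
by exists M => x.
Qed.

(** The expectation of a function of a random element depends on its law only.
    Stating it for two maps h and k covers measure-preserving maps (k = id) as
    well as two realizations of one process on different spaces. *)
Lemma expect_transfer (R : realType) (d d1 d2 : measure_display)
    (T : measurableType d) (S : measurableType d1) (Z : measurableType d2)
    (P : probability T R) (Q : probability S R) (h : T -> Z) (k : S -> Z)
    (F : Z -> R) :
  measurable_fun [set: T] h -> measurable_fun [set: S] k ->
  (forall A, measurable A -> P (h @^-1` A) = Q (k @^-1` A)) -> bounded_mf F ->
  \int[P]_x F (h x) = \int[Q]_x F (k x).
Proof.
move=> mh mk hk bF.
pose h' : {mfun T >-> Z} :=
  MeasurableFun.Pack (MeasurableFun.Class (isMeasurableFun.Build _ _ _ _ _ mh)).
pose k' : {mfun S >-> Z} :=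
  MeasurableFun.Pack (MeasurableFun.Class (isMeasurableFun.Build _ _ _ _ _ mk)).
have mEF : measurable_fun [set: Z] (EFin \o F) by apply/measurable_EFinP; case: bF.
have := @integral_pushforward _ _ _ _ R h' mh P setT (EFin \o F) mEF.
have := @integral_pushforward _ _ _ _ R k' mk Q setT (EFin \o F) mEF.
rewrite !preimage_setT => Ek Eh; rewrite /Rintegral.
rewrite -[in RHS]Ek//; last exact/bounded_mf_integrable/bounded_mf_comp.
rewrite -Eh//; last exact/bounded_mf_integrable/bounded_mf_comp.
by congr fine; apply: eq_measure_integral => A mA _; exact: hk.
Qed.

(** * Paths of an i.i.d. process and resampling of the future *)

Section path_space.
Context (d : measure_display) (T : measurableType d).

Definition cylinder (s : {fset int}) (B : int -> set T) : set (int -> T) :=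
  \bigcap_(i in [set` s]) [set u | B i (u i)].

Lemma measurable_coord (i : int) : measurable_fun [set: pathType T] (fun u : pathType T => u i).
Proof.
move=> _ B mB; rewrite setTI; apply: sub_sigma_algebra.
by exists i => //; exists B => //; rewrite setTI.
Qed.

Lemma measurable_to_path (d' : measure_display) (S : measurableType d')
    (h : S -> pathType T) :
  (forall i, measurable_fun [set: S] (fun x => h x i)) -> measurable_fun [set: S] h.
Proof.
move=> mh; apply: (@measurability _ _ S (pathType T) setT h (coord_events T [set: int])) => //.
move=> _ [_ [i _ [B mB <-]] <-].
by have := mh i measurableT B mB; rewrite !setTI.
Qed.

Lemma measurable_cylinder s B : (forall i, measurable (B i)) ->
  measurable (cylinder s B : set (pathType T)).
Proof.
move=> mB; apply: fin_bigcap_measurable; first exact: finite_fset.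
by move=> i _; have := @measurable_coord i measurableT _ (mB i); rewrite setTI.
Qed.

Context (R : realType).

(** Cylinders are stable under intersection and generate the product
    sigma-algebra, so they determine a finite measure. *)
Lemma path_measure_unique (mu nu : {measure set (pathType T) -> \bar R}) :
  (mu setT < +oo)%E ->
  (forall s B, (forall i, measurable (B i)) -> mu (cylinder s B) = nu (cylinder s B)) ->
  forall A : set (pathType T), measurable A -> mu A = nu A.
Proof.
move=> muoo munu A mA.
pose G : set (set (pathType T)) :=
  [set C | exists s B, (forall i, measurable (B i)) /\ C = cylinder s B].
have Gm : G `<=` measurable by move=> _ [s [B [mB ->]]]; exact: measurable_cylinder.
have GT : G setT.
  exists fset0, (fun=> setT); split; first by move=> i; exact: measurableT.
  by apply/seteqP; split=> // u _ i.
apply: (@g_sigma_algebra_measure_unique _ R (pathType T) G Gm (fun=> setT)) => //.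
- by rewrite bigcup_const//; exists 0%N.
- move=> _ _ [s [B [mB ->]]] [s' [B' [mB' ->]]].
  exists (s `|` s')%fset, (fun i => (if i \in s then B i else setT) `&`
                              (if i \in s' then B' i else setT)); split.
    by move=> i; apply: measurableI; case: ifP => // _; exact: measurableT.
  apply/seteqP; split => [u [us us'] i _ /=|u us].
    by split; case: ifP => // si; do ?[exact: us | exact: us'].
  split=> i /= si.
    by have [|+ _] := us i; rewrite /= ?in_fsetU si.
  by have [|_] := us i; rewrite /= ?in_fsetU si ?orbT.
- by move=> _ [s [B [mB ->]]]; exact: munu.
- apply: sub_smallest2r mA; first exact: smallest_sigma_algebra.
  move=> _ [i _ [B mB <-]]; exists [fset i]%fset, (fun=> B); split => //.
  apply/seteqP; split => [u [_ uB] j|u us].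
    by rewrite /= inE => /eqP ->.
  by split => //; apply: (us i); rewrite /= inE.
Qed.

Definition translate (k : int) (u : pathType T) : pathType T := fun i => u (i + k).

Lemma measurable_translate k : measurable_fun [set: pathType T] (translate k).
Proof. by apply: measurable_to_path => i; exact: (@measurable_coord (i + k)). Qed.

(** The path equal to u strictly before m and to v from m on: if v has the i.i.d.
    law, it is u with its coordinates from m on resampled. *)
Definition splice (m : int) (u v : pathType T) : pathType T :=
  fun i => if i < m then u i else v i.

Lemma measurable_splice m :
  measurable_fun [set: pathType T * pathType T] (fun x => splice m x.1 x.2).
Proof.
apply: measurable_to_path => i; rewrite /splice; case: (i < m).
  exact: measurableT_comp (@measurable_coord i) measurable_fst.
exact: measurableT_comp (@measurable_coord i) measurable_snd.
Qed.

Lemma measurable_splice2 m u : measurable_fun [set: pathType T] (splice m u).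
Proof.
apply: measurable_to_path => i; rewrite /splice; case: (i < m).
  exact: measurable_cst.
exact: (@measurable_coord i).
Qed.

(** Resampling from m and then from m + 1 amounts to resampling inside v from
    m + 1: this is the tower property before integration. *)
Lemma splice_splice m u v w :
  splice (m + 1) (splice m u v) w = splice m u (splice (m + 1) v w).
Proof.
apply/funext => i; rewrite /splice ltzD1; by case: (ltP i m) => [/ltW -> |].
Qed.

Variables (P : probability (pathType T) R) (iidP : iid_law P).
Implicit Types F : pathType T -> R.

Lemma probability_preserving (d' : measure_display) (S : measurableType d')
    (Q : probability S R) (h : S -> pathType T) (mh : measurable_fun [set: S] h) :
  (forall s B, (forall i, measurable (B i)) ->
     Q (h @^-1` cylinder s B) = P (cylinder s B)) ->
  forall A, measurable A -> Q (h @^-1` A) = P A.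
Proof.
move=> hQ A mA.
pose mh_mixin := isMeasurableFun.Build _ _ _ _ _ mh.
pose h' : {mfun S >-> pathType T} := MeasurableFun.Pack (MeasurableFun.Class mh_mixin).
apply: (@path_measure_unique (pushforward Q h') P) => //.
change (Q (h @^-1` setT) < +oo)%E.
by rewrite preimage_setT probability_setT ltry.
Qed.

Lemma translate_preserving k A : measurable A -> P (translate k @^-1` A) = P A.
Proof.
apply: probability_preserving; first exact: measurable_translate.
move=> s B mB.
have -> : translate k @^-1` cylinder s B =
   cylinder [fset (i + k)%R | i in s]%fset (fun i => B (i - k)).
  apply/seteqP; split=> [u us j /= /imfsetP[i /= si ->]|u us i /= si].
    by rewrite addrK; exact: us.
  by have := us (i + k); rewrite /= addrK; apply; apply/imfsetP; exists i.
have [P1 P2] := iidP.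
rewrite /cylinder (P2 _ (fun i => B (i - k)))// P2// big_imfset/=; last by move=> i j _ _ /addIr.
by apply: eq_bigr => i _; rewrite addrK P1// [RHS]P1.
Qed.

(** For i.i.d. coordinates, joining the past of a path to the future of an
    independent copy does not change the law. *)
Lemma splice_preserving m A : measurable A ->
  (P \x P)%E ((fun x => splice m x.1 x.2) @^-1` A) = P A.
Proof.
apply: probability_preserving; first exact: measurable_splice.
move=> s B mB; have [_ P2] := iidP.
have -> : (fun x => splice m x.1 x.2) @^-1` cylinder s B =
  cylinder [fset i in s | (i < m)%R]%fset B `*` cylinder [fset i in s | ~~ (i < m)%R]%fset B.
  apply/seteqP; split=> [[u v] us|[u v] [us us']].
    split=> i /=; rewrite !inE/= => /andP[si im];
      by have := us i si; rewrite /= /splice ?im// (negbTE im).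
  move=> i /= si; rewrite /splice; case: (boolP (i < m)) => im.
    by apply: us; rewrite /= !inE/= si im.
  by apply: us'; rewrite /= !inE/= si im.
transitivity (P (cylinder [fset i in s | (i < m)%R]%fset B) *
  P (cylinder [fset i in s | ~~ (i < m)%R]%fset B))%E.
  by apply: product_measure1E; exact: measurable_cylinder.
rewrite /cylinder !P2//.
rewrite [RHS](bigID (fun i => (i < m)%R))/=.
by rewrite -!big_fset_condE/=.
Qed.

Lemma expect_translate k F : bounded_mf F ->
  \int[P]_x F (translate k x) = \int[P]_x F x.
Proof.
move=> bF; apply: (expect_transfer _ (@measurable_id _ _ setT)) => //.
  exact: measurable_translate.
exact: translate_preserving.
Qed.

(** A version, defined at every u, of the conditional expectation of F given the
    coordinates before m: independence turns conditioning into integrating over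
    a resampled future, so no abstract conditional expectation is involved. *)
Definition cexp (m : int) (F : pathType T -> R) (u : pathType T) : R :=
  \int[P]_v F (splice m u v).

Lemma bounded_mf_splice2 m u F : bounded_mf F -> bounded_mf (fun v => F (splice m u v)).
Proof.
exact: bounded_mf_comp (measurable_splice2 m u).
Qed.

Lemma bounded_mf_splice m F : bounded_mf F ->
  bounded_mf (fun x : pathType T * pathType T => F (splice m x.1 x.2)).
Proof.
exact: bounded_mf_comp (measurable_splice m).
Qed.

Lemma bounded_mf_cexp m F : bounded_mf F -> bounded_mf (cexp m F).
Proof.
move=> bF; split.
  apply: measurableT_comp => //.
  have := bounded_mf_integrable (P \x P)%E (bounded_mf_splice m bF).
  by move=> /measurable_fubini_F.
have [_ [M FM]] := bF; exists M => u.
rewrite -(subr0 (cexp m F u)) -[X in _ - X](expect_cst P 0).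
rewrite -[leRHS](expect_cst P); apply: expect_dist.
- exact: bounded_mf_splice2.
- exact: bounded_mf_cst.
- exact: bounded_mf_cst.
- by move=> x; rewrite subr0.
Qed.

Lemma expect_cexp m F : bounded_mf F -> \int[P]_u cexp m F u = \int[P]_u F u.
Proof.
move=> bF.
rewrite -(expect_transfer (P := (P \x P)%E) (measurable_splice m)
  (@measurable_id _ _ setT) (splice_preserving m) bF).
have := bounded_mf_integrable (P \x P)%E (bounded_mf_splice m bF).
move=> intF; have := integral12_prod_meas1 intF.
rewrite /Rintegral/= => <-; congr fine; apply: eq_integral => u _.
rewrite /fubini_F/= /cexp /Rintegral fineK//.
exact/integrable_fin_num/bounded_mf_integrable/bounded_mf_splice2.
Qed.

Lemma cexp_tower m F u : bounded_mf F ->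
  \int[P]_v cexp (m + 1) F (splice m u v) = cexp m F u.
Proof.
move=> bF.
rewrite -[RHS](expect_cexp (m + 1) (bounded_mf_splice2 m u bF)).
apply: eq_Rintegral => v _; apply: eq_Rintegral => w _.
by rewrite splice_splice.
Qed.

End path_space.

(** * The Azuma-Hoeffding inequality on path space *)

Section martingale_concentration.
Context (d : measure_display) (T : measurableType d) (R : realType).
Variables (P : probability (pathType T) R) (iidP : iid_law P).
Implicit Types F : pathType T -> R.

(** With the coordinates before m fixed at those of u, the next conditional
    expectation varies by at most c and has mean cexp m F u, so Hoeffding's
    lemma applies to it; integrating over u closes the step. *)
Lemma mgf_cexp_step F m c s : bounded_mf F -> 0 <= s ->
  (forall u v : pathType T, (forall i, i < m -> u i = v i) ->
     cexp P (m + 1) F u - cexp P (m + 1) F v <= c) ->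
  \int[P]_u expR (s * cexp P (m + 1) F u) <=
  expR (s ^+ 2 * c ^+ 2 / 8) * \int[P]_u expR (s * cexp P m F u).
Proof.
move=> bF s0 Fc.
have bexp n : bounded_mf (fun u => expR (s * cexp P n F u)).
  apply: bounded_mf_expR; apply: bounded_mfM; first exact: bounded_mf_cst.
  exact: bounded_mf_cexp.
rewrite -(expect_cexp iidP m)// -expectZ//; apply: expect_le.
- exact: bounded_mf_cexp.
- by apply: bounded_mfM => //; exact: bounded_mf_cst.
- move=> u; rewrite -(cexp_tower iidP m u bF); apply: hoeffding_lemma => //.
    exact/bounded_mf_splice2/bounded_mf_cexp.
  by move=> v w; apply: Fc => i im; rewrite /splice im.
Qed.

Lemma mgf_cexp F a N (c : nat -> R) s : bounded_mf F -> 0 <= s ->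
  (forall k (u v : pathType T), (k < N)%N -> (forall i, i < a + k%:Z -> u i = v i) ->
     cexp P (a + k%:Z + 1) F u - cexp P (a + k%:Z + 1) F v <= c k) ->
  \int[P]_u expR (s * cexp P (a + N%:Z) F u) <=
  expR (s ^+ 2 * (\sum_(k < N) c k ^+ 2) / 8) * \int[P]_u expR (s * cexp P a F u).
Proof.
move=> bF s0; elim: N => [_|N IH Fc].
  by rewrite big_ord0 mulr0 mul0r expR0 mul1r addr0.
have -> : a + N.+1%:Z = a + N%:Z + 1 by rewrite -addrA -addn1 PoszD.
apply: (le_trans (mgf_cexp_step bF s0 (fun u v => Fc N u v (ltnSn N)))).
have -> : s ^+ 2 * (\sum_(k < N.+1) c k ^+ 2) / 8 =
    s ^+ 2 * c N ^+ 2 / 8 + s ^+ 2 * (\sum_(k < N) c k ^+ 2) / 8.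
  by rewrite big_ord_recr/=; ring.
rewrite expRD -[leRHS]mulrA.
apply: ler_wpM2l; first exact: expR_ge0.
by apply: IH => k u v kN; apply: Fc; exact: ltnW.
Qed.

(** Azuma-Hoeffding for a function of the coordinates in [a, a + N): the
    conditional expectations run from the constant \int F at a to F at a + N, and
    c k bounds the range of the k-th one given the previous coordinates. *)
Lemma azuma_hoeffding F a N (c : nat -> R) V t : bounded_mf F ->
  (forall u v : pathType T, (forall i, a <= i < a + N%:Z -> u i = v i) -> F u = F v) ->
  (forall k (u v : pathType T), (k < N)%N -> (forall i, i < a + k%:Z -> u i = v i) ->
     cexp P (a + k%:Z + 1) F u - cexp P (a + k%:Z + 1) F v <= c k) ->
  \sum_(k < N) c k ^+ 2 <= V -> 0 < V -> 0 <= t ->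
  fine (P [set u | \int[P]_x F x + t <= F u]) <= expR (- (2 * t ^+ 2 / V)).
Proof.
move=> bF Fdep Fc cV V0 t0.
(* s minimizes - s t + s^2 V / 8. *)
pose s := 4 * t / V.
have s0 : 0 <= s by rewrite /s divr_ge0 ?(ltW V0)// mulr_ge0.
have := mgf_cexp bF s0 Fc.
have -> : cexp P (a + N%:Z) F = F.
  apply/funext => u; rewrite /cexp -[RHS](expect_cst P); apply: eq_Rintegral => v _.
  by apply: Fdep => i /andP[_ iN]; rewrite /splice iN.
have -> : cexp P a F = fun=> \int[P]_x F x.
  apply/funext => u; rewrite /cexp; apply: eq_Rintegral => v _.
  by apply: Fdep => i /andP[ai _]; rewrite /splice ltNge ai.
rewrite expect_cst => mgf.
apply: (le_trans (chernoff_bound _ bF s0 mgf)).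
rewrite -!expRD ler_expR.
apply: (@le_trans _ _ (- (s * t) + s ^+ 2 * V / 8)).
  have : s ^+ 2 * (\sum_(k < N) c k ^+ 2) / 8 <= s ^+ 2 * V / 8.
    by rewrite ler_wpM2r// ler_wpM2l// sqr_ge0.
  lra.
by rewrite le_eqVlt; apply/orP; left; apply/eqP; rewrite /s; field; rewrite gt_eqF.
Qed.

End martingale_concentration.

(** * Oscillations of functions on words over a finite alphabet *)

Section finite_alphabet.
Context (dA : measure_display) (A : measurableType dA) (R : realType).
Variable finA : finite_set [set: A].

(** Enumerating words by a finType makes finite sums and finite unions over words
    available, although the alphabet carries no finType structure. *)
Lemma finite_tuples (n : nat) :
  exists (I : finType) (e : I -> n.-tuple A), forall t, exists i, t = e i.
Proof.
have /finite_fsetP[X XT] := finA.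
exists (n.-tuple X : finType), (map_tuple (val : X -> A)) => t.
have tX i : tnth t i \in X by have : [set: A] (tnth t i) by []; rewrite XT.
exists [tuple FSetSub (tX i) | i < n]; apply: eq_from_tnth => i.
by rewrite tnth_map tnth_mktuple.
Qed.

Lemma bounded_tuple_fun (n : nat) (f : n.-tuple A -> R) : exists M, forall t, `|f t| <= M.
Proof.
have [I [e eP]] := finite_tuples n.
exists (\sum_i `|f (e i)|) => t; have [i ->] := eP t.
by rewrite (bigD1 i)//= lerDl sumr_ge0.
Qed.

Lemma ler_osc (n : nat) (f : n.-tuple A -> R) (j : 'I_n) (a b : n.-tuple A) :
  (forall i, i != j -> tnth a i = tnth b i) -> `|f a - f b| <= osc f j.
Proof.
move=> ab; apply: ub_le_sup; last by exists a, b.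
have [M fM] := bounded_tuple_fun f; exists (M + M) => _ [x [y [_ ->]]].
by rewrite (le_trans (ler_normB _ _))// lerD.
Qed.

Lemma osc_ge0 (n : nat) (f : n.-tuple A -> R) (j : 'I_n) : 0 <= osc f j.
Proof.
pose a : n.-tuple A := [tuple point | i < n].
by rewrite (le_trans _ (ler_osc f (a := a) (b := a) _)).
Qed.

(** Pass from a to b one coordinate at a time; only the coordinates where they
    differ cost anything. *)
Lemma dist_le_osc (n : nat) (f : n.-tuple A -> R) (a b : n.-tuple A) :
  `|f a - f b| <= \sum_(j < n) osc f j * (tnth a j != tnth b j)%:R.
Proof.
(* h k agrees with b on the first k coordinates and with a on the others. *)
pose h k : n.-tuple A := [tuple if (i < k)%N then tnth b i else tnth a i | i < n].
suff H k : (k <= n)%N -> `|f a - f (h k)| <=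
    \sum_(j < n | (j < k)%N) osc f j * (tnth a j != tnth b j)%:R.
  have -> : b = h n.
    by apply: eq_from_tnth => i; rewrite tnth_mktuple ltn_ord.
  rewrite (le_trans (H n (leqnn n)))// le_eqVlt; apply/orP; left; apply/eqP.
  by apply: eq_big => [j|j _]; rewrite ?ltn_ord// tnth_mktuple ltn_ord.
elim: k => [_|k IH kn].
  have -> : h 0%N = a by apply: eq_from_tnth => i; rewrite tnth_mktuple.
  by rewrite subrr normr0 big_pred0.
pose k' := Ordinal kn.
rewrite (bigD1 k')//= (eq_bigl (fun j : 'I_n => (j < k)%N)); last first.
  by move=> j; rewrite ltnS -val_eqE/= ltn_neqAle andbC.
have -> : f a - f (h k.+1) = (f (h k) - f (h k.+1)) + (f a - f (h k)) by ring.
rewrite (le_trans (ler_normD _ _))// lerD// ?IH ?(ltnW kn)//.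
have hE (i : 'I_n) : i != k' -> tnth (h k) i = tnth (h k.+1) i.
  move=> ik; rewrite !tnth_mktuple ltnS [in RHS]leq_eqVlt.
  by rewrite -(inj_eq val_inj)/= in ik; rewrite (negbTE ik).
case: (eqVneq (tnth a k') (tnth b k')) => /= ab; last first.
  by rewrite mulr1; exact: ler_osc.
have -> : h k = h k.+1.
  apply: eq_from_tnth => i; case: (eqVneq i k') => [->|]; last exact: hE.
  by rewrite !tnth_mktuple/= ltnn ltnSn.
by rewrite subrr normr0 mulr0.
Qed.

Variable discreteA : forall B : set A, measurable B.

Lemma measurable_tuple_fun (d : measure_display) (S : measurableType d) (n : nat)
    (f : n.-tuple A -> R) (X : 'I_n -> S -> A) :
  (forall i, measurable_fun [set: S] (X i)) ->
  measurable_fun [set: S] (fun x => f [tuple X i x | i < n]).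
Proof.
move=> mX _ B mB; rewrite setTI.
have [I [e eP]] := finite_tuples n.
rewrite (_ : _ @^-1` B = \bigcup_(i in [set i | B (f (e i))])
    \bigcap_(j in [set: 'I_n]) (X j @^-1` [set tnth (e i) j])).
  apply: fin_bigcup_measurable => // i _; apply: fin_bigcap_measurable => // j _.
  by have := mX j measurableT _ (discreteA [set tnth (e i) j]); rewrite setTI.
apply/seteqP; split => [x /= Bx|x [i Bi /= xi]].
  have [i iE] := eP [tuple X i x | i < n]; exists i => /=; first by rewrite -iE.
  by move=> j _; rewrite /= -iE tnth_mktuple.
rewrite /= (_ : [tuple X i x | i < n] = e i)//.
by apply: eq_from_tnth => j; rewrite tnth_mktuple; exact: xi.
Qed.

Lemma bounded_mf_tuple_fun (d : measure_display) (S : measurableType d) (n : nat)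
    (f : n.-tuple A -> R) (X : 'I_n -> S -> A) :
  (forall i, measurable_fun [set: S] (X i)) ->
  bounded_mf (fun x => f [tuple X i x | i < n]).
Proof.
move=> mX; split; first exact: measurable_tuple_fun.
by have [M fM] := bounded_tuple_fun f; exists M.
Qed.

End finite_alphabet.

(** * Locality of the stopping times *)

Section stopping_times.
Context (d : measure_display) (T : measurableType d) (B : Type) (R : realType).
Variable P : probability (pathType T) R.
Variables (Y : pathType T -> B) (theta1 theta2 : pathType T -> option nat).
Hypothesis finite_theta2 : {ae P, forall u, theta2 u <> None}.
Hypothesis theta_events : forall k l : nat,
  <<s coord_events T [set i | - k%:Z <= i <= l%:Z] >>
    [set u | theta1 u = Some k /\ theta2 u = Some l].
Hypothesis Y_local : forall u v : pathType T,
  (forall i, in_window (theta1 u) (theta2 u) i -> u i = v i) -> Y u = Y v.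

(** Events generated by the coordinates in I cannot separate two paths that agree
    on I, because the events with this property form a sigma-algebra. *)
Lemma generated_event_local (I : set int) (E : set (int -> T)) (u v : int -> T) :
  <<s coord_events T I >> E -> (forall i, I i -> u i = v i) -> E u -> E v.
Proof.
move=> IE uv; suff : E u <-> E v by case.
move: E IE; apply: smallest_sub.
  split=> // [E uvE|F uvF]; first by split=> -[? nE]; split=> // /uvE.
  by split=> -[k _ Fk]; exists k => //; apply/uvF.
by move=> _ [i Ii [C mC <-]]; rewrite /= uv.
Qed.

(** The stopping times are themselves decided inside the window that they
    delimit, so agreement there transports both times and the output. *)
Lemma theta_local (u v : pathType T) k l : theta1 u = Some k -> theta2 u = Some l ->
  (forall i, - k%:Z <= i <= l%:Z -> u i = v i) ->
  [/\ theta1 v = Some k, theta2 v = Some l & Y u = Y v].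
Proof.
move=> uk ul uv.
have [] := @generated_event_local _ _ u v (@theta_events k l) uv; first by [].
move=> vk vl; split => //; apply: Y_local => i [].
by rewrite uk ul => ki il; apply: uv; rewrite ki.
Qed.

Lemma measurable_theta (p : nat -> nat -> bool) :
  measurable ([set u | exists k l, [/\ theta1 u = Some k, theta2 u = Some l & p k l]]
    : set (pathType T)).
Proof.
rewrite (_ : [set u | _] = \bigcup_k \bigcup_(l in [set l | p k l])
   [set u | theta1 u = Some k /\ theta2 u = Some l]).
  apply: bigcupT_measurable => k; apply: bigcup_measurable => l _.
  have := @theta_events k l; apply: sub_smallest2r; first exact: smallest_sigma_algebra.
  by move=> _ [i _ [C mC <-]]; exists i => //; exists C.
apply/seteqP; split => [u [k [l [uk ul pkl]]]|u [k _ [l /= pkl [uk ul]]]].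
  by exists k => //; exists l.
by exists k, l.
Qed.

Variables (r1 r2 : nat).

Definition overrun (u : pathType T) : bool :=
  time_gt (theta1 u) r1 || time_gt (theta2 u) r2.

(** The truncated coding: it depends on the coordinates in [- r1, r2] only, and
    reports an overrun as None instead of a wrong letter. *)
Definition readout (u : pathType T) : option B :=
  if overrun u then None else Some (Y u).

Lemma overrunN u : ~~ overrun u <->
  exists k l, [/\ theta1 u = Some k, theta2 u = Some l & (k <= r1)%N && (l <= r2)%N].
Proof.
rewrite /overrun negb_or; split => [/andP[]|[k [l [-> ->]]]].
  case: (theta1 u) => // k; case: (theta2 u) => // l /=.
  by rewrite -!leqNgt => kr lr; exists k, l; rewrite kr.
by rewrite /= -!leqNgt.
Qed.

Lemma measurable_overrun : measurable ([set u | overrun u] : set (pathType T)).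
Proof.
rewrite -[X in measurable X]setCK; apply: measurableC.
have := measurable_theta (fun k l => (k <= r1)%N && (l <= r2)%N).
congr measurable; apply/seteqP; split => u /=.
  by move=> /overrunN/negP.
by move=> /negP/overrunN.
Qed.

Lemma readout_local (u v : pathType T) :
  (forall i, - r1%:Z <= i <= r2%:Z -> u i = v i) -> readout u = readout v.
Proof.
have half x y : (forall i, - r1%:Z <= i <= r2%:Z -> x i = y i) ->
    ~~ overrun x -> readout x = readout y.
  move=> xy nx; have /overrunN[k [l [xk xl /andP[kr lr]]]] := nx.
  have [|yk yl Yxy] := @theta_local x y k l xk xl.
    by move=> i /andP[ki il]; apply: xy; lia.
  by rewrite /readout /overrun xk xl yk yl Yxy.
move=> uv; case: (boolP (overrun u)) => [ou|]; last exact: half.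
case: (boolP (overrun v)) => [ov|nv]; first by rewrite /readout ou ov.
by apply/esym/half => // i /uv.
Qed.

(** The output is decided by the coordinates after - k. Requiring theta2 finite
    makes this a measurable event, which {theta1 < k} need not be; the two
    differ by a null set. *)
Definition settled (k : nat) : set (pathType T) :=
  [set u | exists m l, [/\ theta1 u = Some m, theta2 u = Some l & (m < k)%N]].

(** Once the output is settled after - k, rewriting the coordinates up to - k
    changes neither the letter nor the report of an overrun. *)
Lemma readout_settled k (u v : pathType T) : settled k u ->
  (forall i, - k%:Z < i -> u i = v i) -> readout v = readout u.
Proof.
move=> [m [l [um ul mk]]] uv.
have [|vm vl Yuv] := @theta_local u v m l um ul.
  by move=> i /andP[mi il]; apply: uv; lia.
by rewrite /readout /overrun um ul vm vl Yuv.
Qed.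

Lemma prob_ge_ge0 k : 0 <= prob_ge P theta1 k.
Proof. by apply: fine_ge0; exact: mu_ext_ge0. Qed.

(** The complement of settled k lies in {theta1 >= k} up to a null set, and the
    outer measure of the latter dominates its measure. *)
Lemma prob_unsettled k : \int[P]_u \1_(~` settled k) u <= prob_ge P theta1 k.
Proof.
have mS : measurable (settled k) := measurable_theta (fun m l => (m < k)%N).
rewrite expect_indic; last exact: measurableC.
have [N [mN PN subN]] := finite_theta2.
have sub : ~` settled k `<=` [set u | time_ge (theta1 u) k] `|` N.
  move=> u nS; have [|n1] := boolP (time_ge (theta1 u) k); first by left.
  right; apply: contrapT => n2; apply: nS.
  have : theta2 u <> None by apply: contrapT => /subN.
  case E2 : (theta2 u) => [l|]// _.
  by case E1 : (theta1 u) n1 => [m|]//=; rewrite -ltnNge => mk; exists m, l.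
apply: fine_le.
- by apply: (fin_num_measure P); exact: measurableC.
- rewrite ge0_fin_numE ?mu_ext_ge0//.
  apply: (@le_lt_trans _ _ (mu_ext P setT)); first exact: le_mu_ext.
  by rewrite measurable_mu_extE//= probability_setT ltry.
- rewrite -measurable_mu_extE; last exact: measurableC.
  apply: (le_trans (le_mu_ext _ sub)).
  apply: (le_trans (outer_measureU2 _ _ _)).
  by rewrite [X in (_ + X)%E]measurable_mu_extE//= PN adde0.
Qed.

End stopping_times.

(** * Concentration of functions of the truncated coding *)

Section coding_concentration.
Context (d : measure_display) (T : measurableType d) (B : eqType) (R : realType).
Variables (P : probability (pathType T) R) (iidP : iid_law P).
Variables (Y : pathType T -> B) (theta1 theta2 : pathType T -> option nat).
Hypothesis finite_theta2 : {ae P, forall u, theta2 u <> None}.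
Hypothesis theta_events : forall k l : nat,
  <<s coord_events T [set i | - k%:Z <= i <= l%:Z] >>
    [set u | theta1 u = Some k /\ theta2 u = Some l].
Hypothesis Y_local : forall u v : pathType T,
  (forall i, in_window (theta1 u) (theta2 u) i -> u i = v i) -> Y u = Y v.
Variables (r1 r2 : nat).

Local Notation rd := (readout Y theta1 theta2 r1 r2).

(** Whether resampling one coordinate may change one readout, as a function of
    the path to the right of that coordinate. The lag e places the coordinate at
    e - r1 relative to the readout: to its left (e < r1) the change is blocked
    if the output is settled after the coordinate; at the readout or up to r2 to
    its right it is always possible; further away it is impossible. *)
Definition influence (e : nat) (u : pathType T) : R :=
  if (e < r1)%N then \1_(~` settled theta1 theta2 (r1 - e)) u
  else if (e <= r1 + r2)%N then 1 else 0.

Definition influence_bound (e : nat) : R :=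
  if (e < r1)%N then prob_ge P theta1 (r1 - e)
  else if (e <= r1 + r2)%N then 1 else 0.

(** The sum of influence_bound over all lags, see sum_influence_bound. *)
Definition influence_total : R :=
  1 + r2%:R + \sum_(1 <= j < r1.+1) prob_ge P theta1 j.

Lemma influence_bound_ge0 e : 0 <= influence_bound e.
Proof.
by rewrite /influence_bound; case: ifP => _; [exact: prob_ge_ge0|case: ifP].
Qed.

Lemma influence_bound_eq0 e : (r1 + r2 < e)%N -> influence_bound e = 0.
Proof.
move=> re; rewrite /influence_bound ltnNge (leq_trans (leq_addr r2 _) (ltnW re))/=.
by rewrite leqNgt re.
Qed.

Lemma sum_influence_bound : \sum_(e < r1 + r2.+1) influence_bound e = influence_total.
Proof.
rewrite big_split_ord/= addrC; congr (_ + _).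
  rewrite (eq_bigr (fun=> 1)); last first.
    by move=> e _; rewrite /influence_bound ltnNge leq_addr/= leq_add2l -ltnS ltn_ord.
  by rewrite sumr_const card_ord -natr1 addrC.
rewrite big_add1/= big_mkord (reindex_inj rev_ord_inj)/=.
apply: eq_bigr => e _; rewrite /influence_bound.
have er : (r1 - e.+1 < r1)%N by rewrite ltn_subrL (leq_ltn_trans _ (ltn_ord e)).
by rewrite er; congr (prob_ge P theta1 _); rewrite subKn.
Qed.

Lemma influence_total_gt0 : 0 < influence_total.
Proof.
rewrite /influence_total -addrA ltr_pwDl// addr_ge0// sumr_ge0// => j _.
exact: prob_ge_ge0.
Qed.

Lemma bounded_mf_influence e : bounded_mf (influence e).
Proof.
rewrite /influence; case: (e < r1)%N.
  apply: bounded_mf_indic; apply: measurableC.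
  exact: (@measurable_theta _ _ _ _ theta_events (fun m l => (m < r1 - e)%N)).
exact: bounded_mf_cst.
Qed.

Lemma expect_influence e : \int[P]_u influence e u <= influence_bound e.
Proof.
rewrite /influence /influence_bound; case: (e < r1)%N; first exact: prob_unsettled.
by rewrite expect_cst.
Qed.

Lemma influence_ge0 e u : 0 <= influence e u.
Proof.
by rewrite /influence; case: ifP => _; [rewrite indicE|case: ifP].
Qed.

Lemma influence_le1 (b : bool) (e : nat) u :
  (b -> ~ ((e < r1)%N /\ settled theta1 theta2 (r1 - e) u) /\ (e <= r1 + r2)%N) ->
  b%:R <= influence e u.
Proof.
case: b => [/(_ isT)[ns er]|_]; last exact: influence_ge0.
rewrite /influence er; case: ifP => // er1.
by rewrite indicE mem_set// => su; apply: ns.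
Qed.

(** The two paths a and b differ at m only, and agree with the independent path
    w after m. If w makes the readout at j + 1 settled after m, then a and b both
    read there what w reads. That event does not involve m or its past, so its
    probability is not affected by conditioning on them: this is why a
    coordinate at distance k on the left has weight P(theta1 >= k), not 1. *)
Lemma readout_influence (k j : nat) (u v w : pathType T) :
  (forall i, i < 1 - r1%:Z + k%:Z -> u i = v i) ->
  (rd (translate j.+1 (splice (1 - r1%:Z + k%:Z + 1) u w)) !=
   rd (translate j.+1 (splice (1 - r1%:Z + k%:Z + 1) v w)))%:R <=
  if (j <= k)%N then influence (k - j) (translate j.+1 w) else 0.
Proof.
move=> uv; set a := splice _ u w; set b := splice _ v w.
set m := 1 - r1%:Z + k%:Z in uv a b *.
have aw i : m < i -> a i = w i by rewrite /a /splice ltzD1 leNgt => ->.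
have bw i : m < i -> b i = w i by rewrite /b /splice ltzD1 leNgt => ->.
have ab i : i != m -> a i = b i.
  rewrite neq_lt => /orP[im|mi]; last by rewrite aw// bw.
  by rewrite /a /b /splice ltzD1 (ltW im) uv.
have far : ~~ ((j <= k)%N && (k - j <= r1 + r2)%N) ->
    rd (translate j.+1 a) = rd (translate j.+1 b).
  move=> njk; apply: (readout_local theta_events Y_local) => i /andP[ri ir].
  rewrite /translate; apply: ab; apply: contra njk => /eqP; rewrite /m => E.
  by apply/andP; split; lia.
case: ifPn => jk; last by rewrite far ?eqxx// (negbTE jk).
apply: influence_le1 => /eqP dab; split; last first.
  by apply: contrapT => /negP njk; apply: dab; apply: far; rewrite negb_and njk orbT.
move=> [er1 sw]; apply: dab.
transitivity (rd (translate j.+1 w)).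
  apply: (readout_settled theta_events Y_local _ _ sw) => // i ki.
  by rewrite /translate aw// /m; lia.
apply/esym; apply: (readout_settled theta_events Y_local _ _ sw) => // i ki.
by rewrite /translate bw// /m; lia.
Qed.

(** Resampling the coordinate 1 - r1 + k moves the conditional expectation of F
    by at most the sum of influence_bound (k - j) * delta j over j, a convolution
    of delta; Schur's test bounds its l2 norm, and Azuma-Hoeffding concludes. *)
Theorem readout_concentration (n : nat) (G : ('I_n -> option B) -> R)
    (delta : 'I_n -> R) (t : R) :
  (forall j, 0 <= delta j) ->
  (forall z z', `|G z - G z'| <= \sum_(j < n) delta j * (z j != z' j)%:R) ->
  0 < \sum_(j < n) delta j ^+ 2 -> 0 <= t ->
  let F := fun u : pathType T => G (fun j => rd (translate j.+1 u)) in
  bounded_mf F ->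
  fine (P [set u | \int[P]_x F x + t <= F u]) <=
  expR (- (2 * t ^+ 2 / (influence_total ^+ 2 * \sum_(j < n) delta j ^+ 2))).
Proof.
move=> delta0 Gdelta sdelta0 t0 F bF.
pose kern k j : R := if (j <= k)%N then influence_bound (k - j) else 0.
pose c k : R := \sum_(j < n) kern k j * delta j.
apply: (@azuma_hoeffding _ _ _ _ iidP F (1 - r1%:Z) (n + r1 + r2) c) => //.
- move=> u v uv; congr G; apply/funext => j.
  apply: (readout_local theta_events Y_local) => i /andP[ri ir].
  by apply: uv; have := ltn_ord j; lia.
- move=> k u v _ uv.
  apply: (le_trans (ler_norm _)).
  have bI (j : 'I_n) : bounded_mf (fun w : pathType T => delta j *
      (if (j <= k)%N then influence (k - j) (translate j.+1 w) else 0)).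
    apply: bounded_mfM; first exact: bounded_mf_cst.
    case: (j <= k)%N; last exact: bounded_mf_cst.
    exact/(bounded_mf_comp (measurable_translate _))/bounded_mf_influence.
  apply: (@le_trans _ _ (\int[P]_w \sum_(j < n) delta j *
      (if (j <= k)%N then influence (k - j) (translate j.+1 w) else 0))).
    apply: expect_dist.
    + exact: bounded_mf_splice2.
    + exact: bounded_mf_splice2.
    + exact: bounded_mf_sum.
    + move=> w; rewrite (le_trans (Gdelta _ _))//; apply: ler_sum => j _.
      by rewrite ler_wpM2l//; exact: readout_influence.
  rewrite expect_sum// /c; apply: ler_sum => j _.
  rewrite mulrC /kern; case: ifP => jk; last first.
    by rewrite expectZ ?expect_cst//; exact: bounded_mf_cst.
  rewrite expectZ; last first.
    exact/(bounded_mf_comp (measurable_translate _))/bounded_mf_influence.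
  rewrite ler_wpM2l// expect_translate//; last exact: bounded_mf_influence.
  exact: expect_influence.
- apply: (@schur_test R 'I_(n + r1 + r2) 'I_n (fun k j => kern k j) delta).
  + by move=> k j; rewrite /kern; case: ifP => // _; exact: influence_bound_ge0.
  + move=> k; rewrite -sum_influence_bound; apply: sum_toeplitz_row.
      exact: influence_bound_ge0.
    by move=> e; rewrite addnS; exact: influence_bound_eq0.
  + move=> j; rewrite -sum_influence_bound; apply: sum_toeplitz_col.
      exact: influence_bound_ge0.
    by move=> e; rewrite addnS; exact: influence_bound_eq0.
- by rewrite mulr_gt0// exprn_gt0// influence_total_gt0.
Qed.

End coding_concentration.

(** * Concentration for finitary codings *)

Section finitary_concentration.
Context (dA : measure_display) (A : measurableType dA) (R : realType).
Variables (finA : finite_set [set: A]) (discreteA : forall B : set A, measurable B).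
Context (d : measure_display) (T : measurableType d).
Variables (P : probability (pathType T) R) (iidP : iid_law P).
Variables (Phi : pathType T -> pathType A) (theta1 theta2 : pathType T -> option nat).
Hypothesis mPhi : measurable_fun [set: pathType T] Phi.
Hypothesis Phi_shift : forall u, Phi (Defs.shift u) = Defs.shift (Phi u).
Hypothesis finite_theta1 : {ae P, forall u, theta1 u <> None}.
Hypothesis finite_theta2 : {ae P, forall u, theta2 u <> None}.
Hypothesis theta_events : forall k l : nat,
  <<s coord_events T [set i | - k%:Z <= i <= l%:Z] >>
    [set u | theta1 u = Some k /\ theta2 u = Some l].
Hypothesis Phi_local : forall u v : pathType T,
  (forall i, in_window (theta1 u) (theta2 u) i -> u i = v i) -> Phi u 0 = Phi v 0.

Lemma coding_translate (k : nat) (u : pathType T) : Phi (translate k u) 0 = Phi u k.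
Proof.
suff -> : Phi (translate k u) = translate k (Phi u) by rewrite /translate add0r.
elim: k u => [|k IH] u.
  have -> : translate 0%N u = u by apply/funext => i; rewrite /translate addr0.
  by apply/funext => i; rewrite /translate addr0.
have -> : translate k.+1%:Z u = Defs.shift (translate k u) :> pathType T.
  by apply/funext => i; rewrite /translate /Defs.shift; congr u; lia.
rewrite Phi_shift IH; apply/funext => i; rewrite /translate /Defs.shift.
by congr (Phi u _); lia.
Qed.

Lemma osc_sums_gt0 (n : nat) (f : n.-tuple A -> R) : (exists a b, f a <> f b) ->
  0 < osc_l1 f /\ 0 < osc_l2sq f.
Proof.
move=> [a [b fab]].
have [j j0] : exists j : 'I_n, 0 < osc f j.
  apply: contrapT => nj; apply: fab; apply/eqP; rewrite -subr_eq0 -normr_le0.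
  apply: (le_trans (dist_le_osc finA f a b)); apply: sumr_le0 => j _.
  rewrite mulr_le0_ge0 ?ler0n// leNgt; apply/negP => j0; apply: nj; by exists j.
split; rewrite /osc_l1 /osc_l2sq (bigD1 j)//= ltr_pwDl ?exprn_gt0// sumr_ge0// => i _.
  exact: osc_ge0.
exact: sqr_ge0.
Qed.

Definition coded_fun (n : nat) (f : n.-tuple A -> R) (u : pathType T) : R :=
  f [tuple Phi u i.+1%:Z | i < n].

(** With F the coded function, F1 its value on the truncated readouts and F2 the
    total oscillation over the overruns, |F - F1| <= F2 and E F2 <= eps / 6, so
    |F - E F| <= |F1 - E F1| + (F2 - E F2) + 2 E F2. Hence a deviation above eps
    forces F1 or F2 to deviate by eps / 3. Centring F2 before bounding it is what
    keeps eps / 3 there, and the constant 9 in the exponent. *)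
Lemma coding_concentration (n : nat) (eps : R) (f : n.-tuple A -> R) (r1 r2 : nat) :
  0 < eps -> (exists a b, f a <> f b) ->
  (P [set u | overrun theta1 theta2 r1 r2 u] <= (eps / (6 * osc_l1 f))%:E)%E ->
  (P [set u | eps < `|coded_fun f u - \int[P]_x coded_fun f x|]%R <=
     (4 * expR (- (2 * eps ^+ 2 /
       (9 * influence_total P theta1 r1 r2 ^+ 2 * osc_l2sq f))))%:E)%E.
Proof.
move=> eps0 fne Pover; set F := coded_fun f.
have [l1 l2] := osc_sums_gt0 fne.
set K := influence_total P theta1 r1 r2.
have K0 : 0 < K by exact: influence_total_gt0.
pose rd := readout (fun u => Phi u 0) theta1 theta2 r1 r2.
pose over u := overrun theta1 theta2 r1 r2 u.
pose a0 : A := point.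
(* G1 and G2 give F1 and F2; where an overrun leaves no letter, G1 takes the
   arbitrary letter a0, which G2 pays for. *)
pose G1 (z : 'I_n -> option A) : R := f [tuple odflt a0 (z i) | i < n].
pose G2 (z : 'I_n -> option A) : R := \sum_(i < n) osc f i * (z i == None)%:R.
have mover : measurable ([set u | over u] : set (pathType T)).
  exact: measurable_overrun.
have G1_lip z z' : `|G1 z - G1 z'| <= \sum_(j < n) osc f j * (z j != z' j)%:R.
  rewrite (le_trans (dist_le_osc finA _ _ _))//; apply: ler_sum => j _.
  rewrite ler_wpM2l ?osc_ge0// !tnth_mktuple.
  by case: (eqVneq (z j) (z' j)) => [->|_]; rewrite ?eqxx// lern1 leq_b1.
have G2_lip z z' : `|G2 z - G2 z'| <= \sum_(j < n) osc f j * (z j != z' j)%:R.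
  rewrite /G2 -sumrB (le_trans (ler_norm_sum _ _ _))//; apply: ler_sum => j _.
  rewrite -mulrBr normrM ger0_norm ?osc_ge0// ler_wpM2l ?osc_ge0//.
  case: (eqVneq (z j) (z' j)) => [->|zz]; first by rewrite subrr normr0.
  case: (z j == None); case: (z' j == None);
    by rewrite ?subrr ?subr0 ?sub0r ?normrN ?normr0 ?normr1.
pose pos (g : ('I_n -> option A) -> R) (u : pathType T) : R :=
  g (fun j => rd (translate j.+1 u)).
have mF : bounded_mf F.
  apply: bounded_mf_tuple_fun => // i.
  exact: measurableT_comp (@measurable_coord _ _ i.+1%:Z) mPhi.
have rdE u : rd u = if over u then None else Some (Phi u 0) by [].
have mF1 : bounded_mf (pos G1).
  apply: bounded_mf_tuple_fun => // i.
  rewrite (_ : (fun u => _) = (fun u : pathType T =>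
     if over (translate i.+1 u) then a0 else Phi (translate i.+1 u) 0)).
    apply: (@measurableT_comp _ _ _ _ _ _ (fun u => if over u then a0 else Phi u 0)).
      apply: measurable_fun_ifT.
      - by apply: (@measurable_fun_bool _ _ _ _ true); rewrite setTI.
      - exact: measurable_cst.
      - exact: measurableT_comp (@measurable_coord _ _ 0) mPhi.
    exact: measurable_translate.
  by apply/funext => u; rewrite rdE; case: (over _).
have b2 j : bounded_mf (fun u : pathType T => osc f j * \1_[set u | over u] (translate j.+1%:Z u)).
  apply: bounded_mfM; first exact: bounded_mf_cst.
  exact: bounded_mf_comp (measurable_translate _) (bounded_mf_indic R mover).
have F2E : pos G2 = fun u => \sum_(j < n) osc f j * \1_[set u | over u] (translate j.+1%:Z u).
  apply/funext => u; apply: eq_bigr => j _; congr (_ * _).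
  rewrite rdE indicE; case: (boolP (over _)) => ov; first by rewrite mem_set.
  by rewrite memNset//; exact/negP.
have mF2 : bounded_mf (pos G2) by rewrite F2E; exact: bounded_mf_sum.
have EF2 : \int[P]_u pos G2 u <= eps / 6.
  rewrite F2E expect_sum//.
  rewrite (eq_bigr (fun j => osc f j * fine (P [set u | over u]))); last first.
    move=> j _; rewrite expectZ.
      by rewrite expect_translate//; [rewrite expect_indic|exact: bounded_mf_indic].
    exact: bounded_mf_comp (measurable_translate _) (bounded_mf_indic R mover).
  rewrite -mulr_suml -/(osc_l1 f) mulrC -ler_pdivlMr//.
  rewrite (_ : eps / 6 / osc_l1 f = eps / (6 * osc_l1 f)); last by field; rewrite gt_eqF.
  by rewrite -lee_fin fineK//; exact: (fin_num_measure P).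
have close u : `|F u - pos G1 u| <= pos G2 u.
  apply: (le_trans (dist_le_osc finA _ _ _)); apply: ler_sum => j _.
  rewrite ler_wpM2l ?osc_ge0// !tnth_mktuple rdE.
  case: (over _) => /=; first by rewrite lern1 leq_b1.
  by rewrite coding_translate eqxx.
have EF1 : `|\int[P]_u F u - \int[P]_u pos G1 u| <= eps / 6.
  by rewrite (le_trans _ EF2)//; exact: expect_dist.
set V := K ^+ 2 * \sum_(j < n) osc f j ^+ 2.
have V0 : 0 < V by rewrite mulr_gt0// exprn_gt0.
set E := expR _.
have tail g : (forall z z', `|g z - g z'| <= \sum_(j < n) osc f j * (z j != z' j)%:R) ->
    bounded_mf (pos g) -> (P [set u | (\int[P]_x pos g x) + eps / 3 <= pos g u]%R <= E%:E)%E.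
  move=> gl bg.
  have mS := measurable_ge_level ((\int[P]_x pos g x) + eps / 3) bg.
  rewrite -(fineK (fin_num_measure P _ mS)) lee_fin.
  have -> : E = expR (- (2 * (eps / 3) ^+ 2 / V)).
    rewrite /E /V; congr expR; congr (- _); rewrite /osc_l2sq; field.
    by rewrite !gt_eqF.
  have := @readout_concentration _ T A R P iidP (fun u => Phi u 0) theta1 theta2
    finite_theta2 theta_events Phi_local r1 r2 n g (osc f) (eps / 3).
  by apply => //; [move=> j; exact: osc_ge0|rewrite divr_ge0// ltW].
have GN_lip z z' : `|- G1 z - - G1 z'| <= \sum_(j < n) osc f j * (z j != z' j)%:R.
  by rewrite -opprD normrN.
have T1 := tail G1 G1_lip mF1.
have TN := tail (fun z => - G1 z) GN_lip (bounded_mfN mF1).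
have T2 := tail G2 G2_lip mF2.
have mD : measurable ([set u | eps < `|F u - \int[P]_x F x|] : set (pathType T)).
  by apply/measurable_gt_level/bounded_mf_norm/bounded_mfD => //; exact: bounded_mf_cst.
set S1 := [set u | _ <= pos G1 u] in T1.
set SN := [set u | _] in TN.
set S2 := [set u | _ <= pos G2 u] in T2.
have mS1 : measurable (S1 : set (pathType T)) by exact: measurable_ge_level.
have mSN : measurable (SN : set (pathType T)) by apply: measurable_ge_level; exact: bounded_mfN.
have mS2 : measurable (S2 : set (pathType T)) by exact: measurable_ge_level.
(* Three one-sided tails: F1 above, F1 below, F2 above. *)
apply: (@le_trans _ _ (P ((S1 `|` SN) `|` S2))).
  apply: le_measure; rewrite ?inE//; first by do 2 apply: measurableU => //.
  move=> u /= Du; apply: contrapT => nS.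
  have n1 : ~ S1 u by move=> h; apply: nS; left; left.
  have n2 : ~ SN u by move=> h; apply: nS; left; right.
  have n3 : ~ S2 u by move=> h; apply: nS; right.
  move: n1 n2 n3 => /negP; rewrite -ltNge => n1 /negP; rewrite -ltNge => n2 /negP.
  rewrite -ltNge => n3.
  have n2' : - pos G1 u < - (\int[P]_x pos G1 x) + eps / 3 by rewrite -expectN.
  have := close u; rewrite ler_norml => /andP[c1 c1'].
  have := EF1; rewrite ler_norml => /andP[c2 c2'].
  move: Du; rewrite ltr_normr => /orP[] Du; lra.
apply: (le_trans (measureU2 _ _ _)) => //; first exact: measurableU.
have -> : (4 * E)%:E = (E%:E + E%:E + E%:E + E%:E)%E by rewrite -!EFinD; congr EFin; ring.
apply: (@le_trans _ _ (E%:E + E%:E + E%:E)%E).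
  by apply: leeD => //; apply: (le_trans (measureU2 _ _ _)) => //; exact: leeD.
by rewrite leeDl// lee_fin expR_ge0.
Qed.

(** The overruns of [- r, r] decrease with r to an event on which one of the
    stopping times is infinite. *)
Lemma overrun_vanishing (eta : R) : 0 < eta ->
  exists r, (P [set u | overrun theta1 theta2 r r u] <= eta%:E)%E.
Proof.
move=> eta0.
pose O r : set (pathType T) := [set u | overrun theta1 theta2 r r u].
have mO r : measurable (O r) by exact: measurable_overrun.
have mI : measurable (\bigcap_r O r) by exact: bigcapT_measurable.
have PI : P (\bigcap_r O r) = 0%E.
  apply: measure_negligible => //.
  apply: (negligibleS _ (negligibleU finite_theta1 finite_theta2)).
  move=> u Ou; case E1 : (theta1 u) => [k|]; last by left; rewrite /= E1 => /(_ erefl).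
  case E2 : (theta2 u) => [l|]; last by right; rewrite /= E2 => /(_ erefl).
  have := Ou (k + l)%N Logic.I; rewrite /O /= /overrun E1 E2 /=.
  by rewrite !ltnNge leq_addr leq_addl.
have O_cvg : P (O r) @[r --> \oo] --> 0%:E.
  rewrite [0%:E](esym PI); apply: nonincreasing_cvg_mu => //.
    by rewrite (le_lt_trans (probability_le1 P (mO 0%N)))// ltry.
  move=> r s rs; apply/subsetPset => u; rewrite /O /= /overrun /time_gt.
  by case: (theta1 u) (theta2 u) => [k|] [l|]//=; lia.
have [r0 _ r0P] := cvgr_lt 0 (fine_cvg O_cvg) eta eta0.
exists r0; have := r0P r0 (leqnn r0) => /= /ltW; rewrite -lee_fin fineK//.
exact: (fin_num_measure P).
Qed.

End finitary_concentration.

Theorem theorem3 (R : realType)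
    (dA : measure_display) (A : measurableType dA)
    (finA : finite_set [set: A])
    (discreteA : forall B : set A, measurable B)
    (U : ptopologicalType) (polishU : polish R U)
    (P : probability (pathType (borelType U)) R) (iidP : iid_law P)
    (d : measure_display) (W : measurableType d) (Q : probability W R)
    (X : int -> {RV Q >-> A}) (statX : stationary X)
    (Phi : pathType (borelType U) -> pathType A)
    (theta1 theta2 : pathType (borelType U) -> option nat)
    (codingX : finitary_coding P X Phi theta1 theta2) :
  exp_rate_concentration X /\
  forall (n : nat) (eps : R) (f : n.-tuple A -> R) (r1 r2 : nat),
    (0 < n)%N -> 0 < eps -> (exists a b, f a <> f b) ->
    (0 < r1)%N -> (0 < r2)%N ->
    (P ([set u | time_gt (theta1 u) r1] `|` [set u | time_gt (theta2 u) r2])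
       <= (eps / (6 * osc_l1 f))%:E)%E ->
    (deviation_prob X f eps <=
       (4 * expR (- (2 * eps ^+ 2 /
          (9 * (1 + r2%:R +
                \sum_(1 <= j < r1.+1) prob_ge P theta1 j) ^+ 2
             * osc_l2sq f))))%:E)%E.
Proof.
have [[mPhi Phi_shift lawX] [fin1 fin2] theta_events Phi_local] := codingX.
have mX : measurable_fun [set: W] (fun w : W => (fun i => X i w) : pathType A).
  by apply: measurable_to_path => i; exact: measurable_funP.
have explicit (n : nat) (eps : R) (f : n.-tuple A -> R) (r1 r2 : nat) :
    0 < eps -> (exists a b, f a <> f b) ->
    (P [set u | overrun theta1 theta2 r1 r2 u] <= (eps / (6 * osc_l1 f))%:E)%E ->
    (deviation_prob X f eps <= (4 * expR (- (2 * eps ^+ 2 /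
       (9 * influence_total P theta1 r1 r2 ^+ 2 * osc_l2sq f))))%:E)%E.
  move=> eps0 fne Pover.
  pose h (x : pathType A) : R := f [tuple x i.+1%:Z | i < n].
  have bh : bounded_mf h.
    by apply: bounded_mf_tuple_fun => // i; exact: measurable_coord.
  set c := fine 'E_Q[fun w => f (block X n w)].
  have cE : c = \int[P]_u coded_fun Phi f u.
    rewrite /c unlock; exact: (expect_transfer mX mPhi lawX bh).
  have mD : measurable [set x : pathType A | eps < `|h x - c|].
    by apply/measurable_gt_level/bounded_mf_norm/bounded_mfD => //; exact: bounded_mf_cst.
  have := coding_concentration finA discreteA iidP mPhi Phi_shift fin2 theta_events
    Phi_local eps0 fne Pover.
  apply: le_trans; rewrite -cE.
  by have := lawX _ mD; rewrite /process_law /pushforward /deviation_prob => ->.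
have overrunE (r1 r2 : nat) : [set u | time_gt (theta1 u) r1] `|` [set u | time_gt (theta2 u) r2] =
    [set u | overrun theta1 theta2 r1 r2 u].
  by apply/seteqP; split => u /=; rewrite /overrun; [move=> /orP|move=> /orP].
split; last first.
  by move=> n eps f r1 r2 _ eps0 fne _ _ Pr; apply: explicit => //; rewrite -overrunE.
(* For the rate function, r1 = r2 is chosen from eps and the l1 norm alone. *)
have radius (p : R * R) : exists r : nat, 0 < p.1 -> 0 < p.2 ->
    (P [set u | overrun theta1 theta2 r r u] <= (p.1 / (6 * p.2))%:E)%E.
  have [p10|np1] := pselect (0 < p.1); last by exists 0%N => /np1.
  have [p20|np2] := pselect (0 < p.2); last by exists 0%N => _ /np2.
  have [|r Pr] := overrun_vanishing fin1 fin2 theta_events (eta := p.1 / (6 * p.2)).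
    by rewrite divr_gt0// mulr_gt0.
  by exists r.
have [rad radP] := choice radius.
pose K x y := influence_total P theta1 (rad (x, y)) (rad (x, y)).
have K0 x y : 0 < K x y by exact: influence_total_gt0.
exists 4, (fun x y => if 0 < x then 2 * x ^+ 2 / (9 * K x y ^+ 2) else 1); split.
  move=> x y; case: ifPn => // x0.
  by rewrite divr_gt0// mulr_gt0// exprn_gt0.
move=> n eps f _ eps0 fne.
have [l1 l2] := osc_sums_gt0 finA fne.
apply: (le_trans (explicit n eps f _ _ eps0 fne (radP (eps, osc_l1 f) eps0 l1))).
rewrite eps0 lee_fin ler_wpM2l// ler_expR lerN2.
rewrite le_eqVlt; apply/orP; left; apply/eqP; rewrite -/(K _ _); field.
by rewrite !gt_eqF// K0.
Qed.
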